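(* Let $(T(t))_{t\ge 0}$ be a $C_0$-semigroup of bounded linear operators on a Banach space $X$, with infinitesimal generator $A$. Then for every $t>0$, $$e^{t\sigma_{QF}(A)}:=\{e^{\lambda t}:\lambda\in\sigma_{QF}(A)\}\subseteq\sigma_{QF}(T(t)),$$ where $\sigma_{QF}$ denotes the quasi-Fredholm spectrum.
   Context: $X$ is a complex Banach space. For a linear operator $S$ with domain $D(S)$ (bounded operators have $D(S)$ equal to the whole space), powers $S^n$ have their natural domains, with $S^0=I$; $N(S)$ and $R(S)$ denote kernel and range, and $R^\infty(S)=\bigcap_{n\ge0}R(S^n)$. $S$ is semi-regular if $R(S)$ is closed and $N(S)\subseteq R^\infty(S)$. A closed operator $S$ on $X$ is quasi-Fredholm if there exists an integer $n\ge 0$ such that $R(S^n)$ is closed and the restriction of $S$ to $R(S^n)$, viewed as an operator in the Banach space $R(S^n)$ with domain $R(S^n)\cap D(S)$ and values in $R(S^n)$, is semi-regular. The quasi-Fredholm spectrum is $\sigma_{QF}(S)=\{\lambda\in\mathbb{C}:\lambda-S\text{ is not quasi-Fredholm}\}$. *)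

(* Defs.v *)
From Stdlib Require Import Reals.
From Coquelicot Require Import Coquelicot.

Set Implicit Arguments.
Unset Strict Implicit.

Local Open Scope R_scope.
Local Open Scope C_scope.

Definition Cexp (z : C) : C :=
  (exp (Re z) * cos (Im z), exp (Re z) * sin (Im z))%R.

Lemma minus_plus_plus_group (G : AbelianGroup) (x y z w : G) :
  minus (plus x y) (plus z w) = plus (minus x z) (minus y w).
Proof.
unfold minus; rewrite opp_plus, <- !plus_assoc; f_equal.
rewrite !plus_assoc; f_equal; apply plus_comm.
Qed.

Section Operators.

Variable X : CompleteNormedModule C_AbsRing.

Lemma scal_zero_left (x : X) : scal (zero : C_AbsRing) x = zero.
Proof. exact (scal_zero_l x). Qed.

Lemma scal_zero_right (a : C_AbsRing) : scal a (zero : X) = zero.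
Proof. exact (scal_zero_r a). Qed.

Lemma scal_plus_right (a : C_AbsRing) (x y : X) :
  scal a (plus x y) = plus (scal a x) (scal a y).
Proof. exact (scal_distr_l a x y). Qed.

Lemma scal_minus_right (a : C_AbsRing) (x y : X) :
  scal a (minus x y) = minus (scal a x) (scal a y).
Proof. exact (scal_minus_distr_l a x y). Qed.

Lemma scal_comm (a b : C_AbsRing) (x : X) :
  scal a (scal b x) = scal b (scal a x).
Proof.
transitivity (scal (mult a b) x); [exact (scal_assoc a b x) |].
transitivity (scal (mult b a) x); [| exact (eq_sym (scal_assoc b a x))].
apply (f_equal (fun c : C_AbsRing => scal c x)), Cmult_comm.
Qed.

Lemma minus_plus_plus (x y z w : X) :
  minus (plus x y) (plus z w) = plus (minus x z) (minus y w).
Proof. exact (minus_plus_plus_group x y z w). Qed.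

Record subspace := Subspace {
  carrier :> X -> Prop;
  carrier_zero : carrier zero;
  carrier_plus : forall x y, carrier x -> carrier y -> carrier (plus x y);
  carrier_scal : forall (a : C_AbsRing) x, carrier x -> carrier (scal a x) }.

Definition full_space : subspace.
Proof. now exists (fun _ => True). Defined.

(* A possibly unbounded linear operator in the subspace Y.  The underlying
   function is total; its values outside the domain are irrelevant. *)
Record operator (Y : subspace) := Operator {
  dom : subspace;
  op_fun :> X -> X;
  dom_sub : forall x, dom x -> Y x;
  app_in : forall x, dom x -> Y (op_fun x);
  app_plus : forall x y, dom x -> dom y -> op_fun (plus x y) = plus (op_fun x) (op_fun y);
  app_scal : forall (a : C_AbsRing) x, dom x -> op_fun (scal a x) = scal a (op_fun x) }.

Lemma app_zero (Y : subspace) (S : operator Y) : S zero = zero.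
Proof.
assert (h := app_scal (o := S) (zero : C_AbsRing) (carrier_zero (dom S))).
now rewrite !scal_zero_left in h.
Qed.

Definition range (Y : subspace) (S : operator Y) : subspace.
Proof.
exists (fun y => exists x, dom S x /\ S x = y).
- exists zero; split; [apply carrier_zero | apply app_zero].
- intros y1 y2 [x1 [h1 <-]] [x2 [h2 <-]]; exists (plus x1 x2).
  split; [now apply carrier_plus | now apply app_plus].
- intros a y [x [h <-]]; exists (scal a x).
  split; [now apply carrier_scal | now apply app_scal].
Defined.

Definition kernel (Y : subspace) (S : operator Y) : subspace.
Proof.
exists (fun x => dom S x /\ S x = zero).
- split; [apply carrier_zero | apply app_zero].
- intros x y [hx ex] [hy ey]; split; [now apply carrier_plus |].
  now rewrite app_plus, ex, ey, plus_zero_l.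
- intros a x [hx ex]; split; [now apply carrier_scal |].
  now rewrite app_scal, ex, scal_zero_right.
Defined.

Definition op_id (Y : subspace) : operator Y.
Proof. now exists Y (fun x => x). Defined.

Definition op_comp (Y : subspace) (S1 S2 : operator Y) : operator Y.
Proof.
unshelve refine (@Operator Y
  (@Subspace (fun x => dom S2 x /\ dom S1 (S2 x)) _ _ _)
  (fun x => S1 (S2 x)) _ _ _ _).
- split; [| rewrite app_zero]; apply carrier_zero.
- intros x y [hx hx'] [hy hy']; split; [now apply carrier_plus |].
  now rewrite app_plus by easy; apply carrier_plus.
- intros a x [hx hx']; split; [now apply carrier_scal |].
  now rewrite app_scal by easy; apply carrier_scal.
- now intros x [hx _]; apply dom_sub in hx.
- now intros x [_ hx]; apply app_in.
- intros x y [hx hx'] [hy hy']; now rewrite !app_plus.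
- intros a x [hx hx']; now rewrite !app_scal.
Defined.

Fixpoint op_pow (Y : subspace) (S : operator Y) (n : nat) : operator Y :=
  match n with
  | O => op_id Y
  | Datatypes.S m => op_comp S (op_pow S m)
  end.

Definition op_shift (Y : subspace) (lambda : C_AbsRing) (S : operator Y) : operator Y.
Proof.
exists (dom S) (fun x => minus (scal lambda x) (S x)).
- apply dom_sub.
- intros x hx; unfold minus; rewrite <- (scal_opp_one (S x)).
  apply carrier_plus; apply carrier_scal.
  + now apply dom_sub in hx.
  + now apply app_in.
- intros x y hx hy; rewrite app_plus by easy.
  now rewrite scal_plus_right, minus_plus_plus.
- intros a x hx; rewrite app_scal by easy.
  now rewrite scal_minus_right, (scal_comm a lambda).
Defined.

Lemma range_pow_invariant (Y : subspace) (S : operator Y) (n : nat) (x : X) :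
  range (op_pow S n) x -> dom S x -> range (op_pow S n) (S x).
Proof.
intros [y [hy <-]]; revert y hy; induction n as [|n IH]; intros y hy hS.
- exists (S y); split; [| easy]; now apply app_in.
- destruct hy as [hy hy'].
  destruct (IH y hy hy') as [z [hz ez]].
  exists z; simpl; rewrite ez; now repeat split.
Qed.

Definition op_restrict (Y : subspace) (S : operator Y) (n : nat) :
  operator (range (op_pow S n)).
Proof.
unshelve refine (@Operator (range (op_pow S n))
  (@Subspace (fun x => range (op_pow S n) x /\ dom S x) _ _ _) S _ _ _ _).
- split; apply carrier_zero.
- intros x y [hx hx'] [hy hy']; split; now apply carrier_plus.
- intros a x [hx hx']; split; now apply carrier_scal.
- now intros x [hx _].
- intros x [hx hx']; now apply range_pow_invariant.
- intros x y [_ hx] [_ hy]; now apply app_plus.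
- intros a x [_ hx]; now apply app_scal.
Defined.

(* D is closed for the topology induced on Y, where D is included in Y. *)
Definition closed_in (Y : subspace) (D : X -> Prop) : Prop :=
  forall x, Y x -> ~ within Y (locally x) (fun z => ~ D z) -> D x.

Definition hyper_range (Y : subspace) (S : operator Y) (x : X) : Prop :=
  forall n, range (op_pow S n) x.

Definition semi_regular (Y : subspace) (S : operator Y) : Prop :=
  closed_in Y (range S) /\ forall x, kernel S x -> hyper_range S x.

Definition closed_operator (S : operator full_space) : Prop :=
  closed (fun p : X * X => dom S (fst p) /\ snd p = S (fst p)).

Definition quasi_Fredholm (S : operator full_space) : Prop :=
  closed_operator S /\
  exists n, closed (range (op_pow S n)) /\ semi_regular (op_restrict S n).

Definition QF_spectrum (S : operator full_space) (lambda : C_AbsRing) : Prop :=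
  ~ quasi_Fredholm (op_shift lambda S).

Definition bounded_operator (L : X -> X) (hL : is_linear L) :
  operator full_space.
Proof.
exists full_space L; try easy.
- intros x y _ _; exact (linear_plus _ hL x y).
- intros a x _; exact (linear_scal _ hL a x).
Defined.

(* Values at negative times are irrelevant. *)
Record C0_semigroup := C0Semigroup {
  semigroup :> R -> X -> X;
  semigroup_linear : forall t : R, (0 <= t)%R -> is_linear (semigroup t);
  semigroup_zero : forall x, semigroup 0%R x = x;
  semigroup_add : forall s t : R, (0 <= s)%R -> (0 <= t)%R ->
    forall x, semigroup (s + t)%R x = semigroup s (semigroup t x);
  semigroup_continuous : forall x,
    filterlim (fun t => semigroup t x) (at_right 0%R) (locally x) }.

Definition generator_lim (T : C0_semigroup) (x y : X) : Prop :=
  filterlim (fun h : R => scal (RtoC (/ h) : C_AbsRing) (minus (T h x) x))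
    (at_right 0%R) (locally y).

Lemma generator_lim_unique (T : C0_semigroup) (x y z : X) :
  generator_lim T x y -> generator_lim T x z -> y = z.
Proof. apply (filterlim_locally_unique (V := X)). Qed.

Lemma generator_lim_iota (T : C0_semigroup) (x y : X) :
  generator_lim T x y -> iota (generator_lim T x) = y.
Proof.
intros h; apply (generator_lim_unique (T := T) (x := x)); [| easy].
apply (iota_correct (generator_lim T x)); exists y; split; [easy |].
intros z; now apply generator_lim_unique.
Qed.

Lemma at_right_0_pos : at_right 0%R (fun h : R => (0 <= h)%R).
Proof. exists (mkposreal 1 Rlt_0_1); intros h _; apply Rlt_le. Qed.

Lemma generator_lim_plus (T : C0_semigroup) (x1 x2 y1 y2 : X) :
  generator_lim T x1 y1 -> generator_lim T x2 y2 ->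
  generator_lim T (plus x1 x2) (plus y1 y2).
Proof.
intros h1 h2; unfold generator_lim.
eapply filterlim_ext_loc;
  [| exact (filterlim_comp_2 _ _ _ h1 h2 (filterlim_plus (V := X) y1 y2))].
generalize at_right_0_pos; apply filter_imp; intros h hh.
rewrite (linear_plus _ (semigroup_linear T hh)).
now rewrite minus_plus_plus, scal_plus_right.
Qed.

Lemma generator_lim_scal (T : C0_semigroup) (a : C_AbsRing) (x y : X) :
  generator_lim T x y -> generator_lim T (scal a x) (scal a y).
Proof.
intros h1; unfold generator_lim.
eapply filterlim_ext_loc;
  [| exact (filterlim_comp _ _ _ _ _ _ _ _ h1 (filterlim_scal_r (V := X) a y))].
generalize at_right_0_pos; apply filter_imp; intros h hh.
rewrite (linear_scal _ (semigroup_linear T hh)).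
now rewrite <- scal_minus_right, scal_comm.
Qed.

Lemma generator_lim_zero (T : C0_semigroup) : generator_lim T zero zero.
Proof.
unfold generator_lim.
eapply filterlim_ext_loc; [| apply filterlim_const].
generalize at_right_0_pos; apply filter_imp; intros h hh.
assert (h0 : T h zero = zero).
{ rewrite <- (scal_zero_left zero) at 1.
  transitivity (scal (zero : C_AbsRing) (T h zero)).
  - exact (linear_scal _ (semigroup_linear T hh) zero zero).
  - apply scal_zero_left. }
rewrite h0; symmetry.
transitivity (scal (RtoC (/ h) : C_AbsRing) (zero : X)).
- apply f_equal; exact (minus_eq_zero (zero : X)).
- apply scal_zero_right.
Qed.

Definition generator (T : C0_semigroup) : operator full_space.
Proof.
unshelve refine (@Operator full_space
  (@Subspace (fun x => exists y, generator_lim T x y) _ _ _)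
  (fun x => iota (generator_lim T x)) _ _ _ _); try easy.
- exists zero; apply generator_lim_zero.
- intros x1 x2 [y1 h1] [y2 h2]; exists (plus y1 y2).
  now apply generator_lim_plus.
- intros a x [y h]; exists (scal a y); now apply generator_lim_scal.
- intros x1 x2 [y1 h1] [y2 h2].
  rewrite (generator_lim_iota h1), (generator_lim_iota h2).
  now apply generator_lim_iota, generator_lim_plus.
- intros a x [y h]; rewrite (generator_lim_iota h).
  now apply generator_lim_iota, generator_lim_scal.
Defined.

Definition semigroup_operator (T : C0_semigroup) (t : R) (ht : (0 <= t)%R) :
  operator full_space :=
  bounded_operator (semigroup_linear T ht).

End Operators.

(* Main.v *)
Require Import Defs.
From Stdlib Require Import Reals Lra Lia ClassicalEpsilon.
From Coquelicot Require Import Coquelicot.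

(** Put S(r) = e^{-lambda r} T(r), B = lambda - A, C = e^{lambda t} - T(t), and let
    J x be the integral of S(r) x and G x that of (1 - r/t) S(r) x over [0, t].
    Then L = e^{lambda t} J satisfies C = B L, hence C = L B on D(B), and integrating
    by parts gives the Bezout identity B G + (1/t) J = I with G, J commuting with B.
    From it, L y in R(B^n) forces y in R(B^n), so that R(B^n) is the preimage of R(C^n)
    under the bounded operator L^n, and a vector of N(B) in R(B^n) lies in N(C) and in
    R(C^n).  Thus the three conditions defining quasi-Fredholmness pass from C to B. *)

Set Implicit Arguments.
Unset Strict Implicit.

(** * Factorization and ranges of powers *)

Section Algebra.

Variable X : CompleteNormedModule C_AbsRing.

(** L has no inverse in general, and the Bezout identity is what replaces one: it lets L be
    cancelled inside the ranges of powers. The weight of G is 1 at 0 and 0 at t, so that of the two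
    boundary terms of the integration by parts only x survives, while its constant slope [-1/t]
    leaves the multiple of J. No continuity of the unbounded B is ever used: closed sets are pulled
    back along iterates of L, and B enters only through algebra and through its graph. The semigroup
    is only known to be strongly right-continuous at 0. Integrating orbits requires continuity at
    every time, hence operator bounds that are uniform on compact intervals, hence the uniform
    boundedness principle. The integrals are formed over real scalars; complex homogeneity is
    recovered afterwards. *)

Lemma closed_closed_in (Y : subspace X) (D : X -> Prop) :
  closed D -> closed_in Y D.
Proof.
intros h x _ hx; apply h; intros hl; apply hx.
revert hl; unfold within; apply filter_imp; auto.
Qed.

Lemma closed_in_closed (Y : subspace X) (D : X -> Prop) :
  (forall x, D x -> Y x) -> closed Y -> closed_in Y D -> closed D.
Proof.
intros hDY hY hD x hx; apply hD.
- apply hY; intros hl; apply hx; revert hl; apply filter_imp; auto.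
- intros hl; apply hx; revert hl; unfold within; apply filter_imp.
  intros z hz hDz; exact (hz (hDY z hDz) hDz).
Qed.

(** * Powers of an operator and of its restrictions to ranges *)

Section Powers.

Variable S : operator (full_space X).

Lemma op_pow_add (k n : nat) (x : X) :
  (dom (op_pow S (k + n)) x <-> dom (op_pow S n) x /\ dom (op_pow S k) (op_pow S n x)) /\
  op_pow S (k + n) x = op_pow S k (op_pow S n x).
Proof.
induction k as [|k [IHd IHe]]; simpl.
- tauto.
- rewrite IHe; tauto.
Qed.

(** Besides the domain of [S], the restriction asks that each intermediate value [S^k x] lie in
    R(S^n) again. This is automatic: if x = S^n z, then S^k x = S^n (S^k z). *)
Lemma op_restrict_pow (n k : nat) (x : X) :
  (dom (op_pow (op_restrict S n) k) x <-> range (op_pow S n) x /\ dom (op_pow S k) x) /\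
  op_pow (op_restrict S n) k x = op_pow S k x.
Proof.
induction k as [|k [IHd IHe]]; cbn [op_pow].
- simpl; tauto.
- split; [| simpl; now rewrite IHe].
  change (dom (op_pow (op_restrict S n) k) x /\
    (range (op_pow S n) (op_pow (op_restrict S n) k x) /\
     dom S (op_pow (op_restrict S n) k x)) <->
    range (op_pow S n) x /\ dom (op_pow S k) x /\ dom S (op_pow S k x)).
  rewrite IHe; split; [tauto |].
  intros [hr [hk hS]]; split; [tauto |]; split; [| easy].
  destruct hr as [z [hz <-]].
  assert (h : dom (op_pow S (k + n)) z) by now apply op_pow_add.
  rewrite <- (proj2 (op_pow_add k n z)).
  rewrite Nat.add_comm in h |- *.
  exists (op_pow S k z); apply op_pow_add in h.
  split; [easy | symmetry; apply op_pow_add].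
Qed.

Lemma range_op_restrict_pow (n k : nat) (y : X) :
  range (op_pow (op_restrict S n) k) y <-> range (op_pow S (k + n)) y.
Proof.
split.
- intros [x [hx <-]]; apply op_restrict_pow in hx.
  rewrite (proj2 (op_restrict_pow n k x)).
  destruct hx as [[z [hz <-]] hx]; exists z; split.
  + now apply op_pow_add.
  + apply op_pow_add.
- intros [z [hz <-]]; rewrite (proj2 (op_pow_add k n z)).
  apply op_pow_add in hz; exists (op_pow S n z); split.
  + apply op_restrict_pow; split; [now exists z | easy].
  + apply op_restrict_pow.
Qed.

Lemma range_op_restrict (n : nat) (y : X) :
  range (op_restrict S n) y <-> range (op_pow S (Datatypes.S n)) y.
Proof.
split.
- intros [x [[[z [hz <-]] hx] <-]]; now exists z.
- intros [z [[hz hz'] <-]]; exists (op_pow S n z).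
  repeat split; [now exists z | easy].
Qed.

Lemma range_op_pow_S (n : nat) (y : X) :
  range (op_pow S (Datatypes.S n)) y -> range (op_pow S n) y.
Proof.
intros h; apply range_op_restrict in h; destruct h as [x [[hx hx'] <-]].
now apply (range_pow_invariant (S := S)).
Qed.

Lemma op_pow_commute (K : X -> X)
  (hK : forall x, dom S x -> dom S (K x) /\ S (K x) = K (S x)) (n : nat) (x : X) :
  dom (op_pow S n) x -> dom (op_pow S n) (K x) /\ op_pow S n (K x) = K (op_pow S n x).
Proof.
induction n as [|n IH]; [easy |].
intros [h h']; destruct (IH h) as [hd he].
destruct (hK _ h') as [hd' he']; simpl; rewrite he; tauto.
Qed.

(** Eliminates the restricted operator, leaving conditions on ranges in X that can be pulled back
    along L. The range of the restriction is R(S^(n+1)), and closed in the closed subspace R(S^n)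
    means closed in X. *)
Lemma quasi_Fredholm_iff :
  quasi_Fredholm S <-> closed_operator S /\ exists n,
    closed (range (op_pow S n)) /\ closed (range (op_pow S (Datatypes.S n))) /\
    forall x, kernel S x -> range (op_pow S n) x -> hyper_range S x.
Proof.
(* The ranges of the powers decrease, so dropping the first n of them does not change their
   intersection. *)
assert (hr : forall n x, hyper_range (op_restrict S n) x <-> hyper_range S x).
{ intros n x; split; intros h k.
  - specialize (h k); apply range_op_restrict_pow in h.
    revert h; induction n as [|n IH]; [now rewrite Nat.add_0_r |].
    rewrite Nat.add_succ_r; intros h; now apply IH, range_op_pow_S.
  - apply range_op_restrict_pow, h. }
split; intros [hc [n [hn h]]]; split; try easy; exists n; split; try easy.
- destruct h as [h1 h2]; split.
  + apply (@closed_in_closed (range (op_pow S n))); try easy.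
    * apply range_op_pow_S.
    * intros x hx hl; apply range_op_restrict, h1; [easy |].
      intros hl'; apply hl; revert hl'; unfold within; apply filter_imp.
      intros z hz hz' hz''; now apply (hz hz'), range_op_restrict.
  + intros x [hx hx'] hn'; apply (hr n), h2; now repeat split.
- destruct h as [h1 h2]; split.
  + intros x hx hl; apply range_op_restrict.
    apply (closed_closed_in (Y := range (op_pow S n)) h1); [easy |].
    intros hl'; apply hl; revert hl'; unfold within; apply filter_imp.
    intros z hz hz' hz''; now apply (hz hz'), range_op_restrict.
  + intros x [[hx hx'] hx'']; apply hr, h2; now repeat split.
Qed.

End Powers.

Lemma is_linear_iter (L : X -> X) (n : nat) :
  is_linear L -> is_linear (Nat.iter n L).
Proof.
intros hL; induction n as [|n IH]; [exact is_linear_id |].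
exact (is_linear_comp _ _ IH hL).
Qed.

(** * Transfer of quasi-Fredholmness along a Bezout identity *)

Section Bezout.

Variables (B C : operator (full_space X)) (L G : X -> X) (c : C_AbsRing).

Hypothesis L_linear : is_linear L.
Hypothesis G_zero : G zero = zero.
Hypothesis L_dom : forall x, dom B (L x).
Hypothesis B_L : forall x, B (L x) = C x.
Hypothesis L_B : forall x, dom B x -> L (B x) = C x.
Hypothesis C_dom : forall x, dom C x.
Hypothesis G_dom : forall x, dom B (G x).
Hypothesis B_G : forall x, dom B x -> B (G x) = G (B x).
Hypothesis bezout : forall x, x = plus (B (G x)) (scal c (L x)).

Lemma op_pow_L (n : nat) (x : X) :
  dom (op_pow B n) x -> dom (op_pow B n) (L x) /\ op_pow B n (L x) = L (op_pow B n x).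
Proof.
apply op_pow_commute; intros y hy; split; [easy |].
now rewrite B_L, L_B.
Qed.

Lemma op_pow_G (n : nat) (x : X) :
  dom (op_pow B n) x -> dom (op_pow B n) (G x) /\ op_pow B n (G x) = G (op_pow B n x).
Proof. apply op_pow_commute; auto. Qed.

Lemma op_pow_iter (n : nat) (x : X) :
  dom (op_pow B n) (Nat.iter n L x) /\ op_pow B n (Nat.iter n L x) = op_pow C n x.
Proof.
induction n as [|n [IHd IHe]]; [easy |].
destruct (op_pow_L IHd) as [hd he]; simpl.
rewrite he, IHe, B_L; auto.
Qed.

Lemma iter_op_pow (n : nat) (x : X) :
  dom (op_pow B n) x -> Nat.iter n L (op_pow B n x) = op_pow C n x.
Proof.
(* L and C commute, since L C = L B L = C L. *)
assert (hLC : forall k y, Nat.iter k L (C y) = C (Nat.iter k L y)).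
{ intros k y; induction k as [|k IH]; [easy |]; simpl.
  now rewrite IH, <- (B_L (Nat.iter k L y)), L_B. }
induction n as [|n IH]; [easy |]; intros [h h'].
rewrite Nat.iter_succ_r; simpl; rewrite L_B, hLC, IH; easy.
Qed.

(** By induction y = B^n v. Then B G y = B^(n+1) G v because G commutes with B, while c L y lies in
    R(B^(n+1)) by assumption; the Bezout identity adds the two up to y. *)
Lemma range_op_pow_L_inv (n : nat) (y : X) :
  range (op_pow B n) (L y) -> range (op_pow B n) y.
Proof.
induction n as [|n IH]; [now exists y |]; intros h.
destruct (IH (range_op_pow_S h)) as [v [hv ev]].
rewrite (bezout y); apply carrier_plus; [| now apply carrier_scal].
destruct (op_pow_G hv) as [hd he].
exists (G v); simpl; rewrite he, ev; auto.
Qed.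

Lemma range_op_pow_iff (n : nat) (y : X) :
  range (op_pow B n) y <-> range (op_pow C n) (Nat.iter n L y).
Proof.
split.
- intros [x [hx <-]]; exists x; split; [| now rewrite iter_op_pow].
  clear hx; induction n as [|n IH]; [easy | now split].
- intros [z [_ hz]].
  assert (h : range (op_pow B n) (Nat.iter n L y)).
  { rewrite <- hz, <- (proj2 (op_pow_iter n z)).
    exists (Nat.iter n L z); split; [apply op_pow_iter | easy]. }
  (* The factors L are cancelled one at a time, the exponent n of B staying fixed. *)
  assert (hk : forall k, range (op_pow B n) (Nat.iter k L y) -> range (op_pow B n) y).
  { intros k; induction k as [|k IH]; [easy |].
    intros hk; now apply IH, range_op_pow_L_inv. }
  exact (hk n h).
Qed.

Lemma closed_range_op_pow (n : nat) :
  closed (range (op_pow C n)) -> closed (range (op_pow B n)).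
Proof.
intros h.
apply (closed_ext (fun y => range (op_pow C n) (Nat.iter n L y))).
- intros y; symmetry; apply range_op_pow_iff.
- apply closed_comp; [| easy].
  intros y; exact (linear_cont _ y (is_linear_iter n L_linear)).
Qed.

(** On N(B) the term B G x = G B x vanishes and Bezout reduces to x = c L x. Hence x is a multiple
    of L^n x, which lies in R(C^n) as soon as x lies in R(B^n). *)
Lemma kernel_range_C (n : nat) (x : X) :
  kernel B x -> range (op_pow B n) x -> kernel C x /\ range (op_pow C n) x.
Proof.
intros [hx ex] hr; split.
{ split; [easy |]; rewrite <- L_B, ex by easy; apply (linear_zero L L_linear). }
assert (hcL : x = scal c (L x)).
{ rewrite (bezout x) at 1; rewrite B_G, ex, G_zero by easy; apply plus_zero_l. }
assert (hn : exists a, x = scal a (Nat.iter n L x)).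
{ clear hr; induction n as [|n [a ha]].
  - exists one; symmetry; exact (scal_one x).
  - exists (mult c a).
    transitivity (scal c (scal a (L (Nat.iter n L x)))); [| apply scal_assoc].
    rewrite hcL at 1; rewrite ha at 1; now rewrite (linear_scal _ L_linear). }
destruct hn as [a ha]; rewrite ha; apply carrier_scal.
now apply range_op_pow_iff.
Qed.

Lemma quasi_Fredholm_factor :
  closed_operator B -> quasi_Fredholm C -> quasi_Fredholm B.
Proof.
intros hB hC; apply quasi_Fredholm_iff in hC; destruct hC as [_ [n [h0 [h1 hk]]]].
apply quasi_Fredholm_iff; split; [easy |]; exists n.
split; [| split]; try now apply closed_range_op_pow.
intros x hx hr m; destruct (kernel_range_C hx hr) as [hx' hr'].
(* C^m z = B^m (L^m z), so R(C^m) is contained in R(B^m) for every m. *)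
destruct (hk x hx' hr' m) as [z [_ <-]].
exists (Nat.iter m L z); apply op_pow_iter.
Qed.

End Bezout.

End Algebra.

Local Open Scope R_scope.

(** * Real normed modules and uniform boundedness *)

Section AbelianGroups.

Variable G : AbelianGroup.
Implicit Types x y : G.

Lemma minus_plus_cancel x y : minus (plus x y) x = y.
Proof.
unfold minus; rewrite (plus_comm x), <- plus_assoc.
fold (minus x x); now rewrite minus_eq_zero, plus_zero_r.
Qed.

Lemma plus_minus_cancel x y : plus x (minus y x) = y.
Proof.
unfold minus; rewrite (plus_comm y), plus_assoc.
transitivity (plus (minus x x) y); [easy |].
now rewrite minus_eq_zero, plus_zero_l.
Qed.

Lemma minus_minus_cancel x y : minus (minus x y) x = opp y.
Proof. apply minus_plus_cancel. Qed.

Lemma plus_minus_minus x y : minus (plus x y) (minus x y) = plus y y.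
Proof.
change (minus x y) with (plus x (opp y)).
rewrite minus_plus_plus_group, minus_eq_zero, plus_zero_l.
unfold minus; now rewrite opp_opp.
Qed.

Lemma minus_minus_swap x y z : minus (minus x y) z = minus (minus x z) y.
Proof. unfold minus; now rewrite <- !plus_assoc, (plus_comm (opp y)). Qed.

Lemma minus_zero_minus_opp x y : minus (minus zero x) (opp y) = minus y x.
Proof. unfold minus; now rewrite plus_zero_l, opp_opp, plus_comm. Qed.

End AbelianGroups.

Section RealModules.

Variable V : NormedModule R_AbsRing.

Lemma norm_scal_eq (a : R) (x : V) : norm (scal a x) = Rabs a * norm x.
Proof.
apply Rle_antisym; [exact (norm_scal a x) |].
destruct (Req_dec a 0) as [-> | ha].
- rewrite Rabs_R0, Rmult_0_l; apply norm_ge_0.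
- assert (h : norm x <= Rabs (/ a) * norm (scal a x)).
  { rewrite <- (scal_one x) at 1.
    replace (one : R_AbsRing) with (mult (/ a) a : R_AbsRing) by (now apply Rinv_l).
    rewrite <- scal_assoc; exact (norm_scal (/ a : R_AbsRing) (scal a x)). }
  rewrite Rabs_inv in h; assert (h0 := Rabs_pos_lt a ha).
  apply (Rmult_le_compat_l (Rabs a)) in h; [| lra].
  now rewrite <- Rmult_assoc, Rinv_r, Rmult_1_l in h by lra.
Qed.

Lemma norm_minus_diag (x : V) : norm (minus x x) = 0.
Proof. rewrite minus_eq_zero; apply norm_zero. Qed.

Lemma norm_minus_sym (x y : V) : norm (minus x y) = norm (minus y x).
Proof. now rewrite <- (opp_minus y x), norm_opp. Qed.

Lemma norm_minus_triangle (x y z : V) :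
  norm (minus x z) <= norm (minus x y) + norm (minus y z).
Proof. rewrite (minus_trans y x z); apply norm_triangle. Qed.

Lemma linear_minus (U : V -> V) (x y : V) :
  is_linear U -> U (minus x y) = minus (U x) (U y).
Proof.
intros hU; transitivity (plus (U x) (U (opp y))).
- exact (linear_plus U hU x (opp y)).
- now rewrite linear_opp.
Qed.

Lemma norm_plus_minus_max (x y : V) :
  norm y <= Rmax (norm (plus x y)) (norm (minus x y)).
Proof.
assert (h : scal 2 y = minus (plus x y) (minus x y)).
{ transitivity (plus y y); [| symmetry; exact (plus_minus_minus x y)].
  replace 2 with (plus one one : R_AbsRing) by (unfold plus, one; simpl; lra).
  now rewrite scal_distr_r, scal_one. }
assert (h2 : norm (scal 2 y) <= norm (plus x y) + norm (minus x y)).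
{ rewrite h; unfold minus at 1; rewrite <- (norm_opp (minus x y)); apply norm_triangle. }
rewrite norm_scal_eq, Rabs_pos_eq in h2 by lra.
unfold Rmax; destruct (Rle_dec _ _); lra.
Qed.

Lemma scal_inv_scal (a : R) (x : V) : a <> 0 -> scal (/ a) (scal a x) = x.
Proof.
intros ha; rewrite scal_assoc.
replace (mult (/ a) a) with (one : R_AbsRing) by (symmetry; now apply Rinv_l).
apply scal_one.
Qed.

Lemma scal_inv_minus (a : R) (x y : V) :
  a <> 0 -> scal (/ a) (minus x (scal a y)) = minus (scal (/ a) x) y.
Proof.
intros ha; rewrite <- (scal_inv_scal y ha) at 2.
exact (scal_minus_distr_l (/ a : R_AbsRing) x (scal a y)).
Qed.

Lemma scal_R0 (x : V) : scal 0 x = zero.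
Proof. exact (scal_zero_l x). Qed.

Lemma scal_R1 (x : V) : scal 1 x = x.
Proof. exact (scal_one x). Qed.

Lemma minus_zero_r (x : V) : minus x zero = x.
Proof. unfold minus; rewrite opp_zero; exact (plus_zero_r x). Qed.

(** Splits the difference quotient of the semigroup at an orbit integral [u] over [0, a]: [x] and
    [y] are the integrals over [0, a + h] and [0, h], and [z] comes from the slope of the weight. *)
Lemma scal_inv_quotient (q h : R) (x y z u : V) : h <> 0 ->
  scal (/ h) (minus (minus (minus x y) (scal (q * h) z)) u) =
  minus (minus (scal (/ h) (minus x u)) (scal (/ h) y)) (scal q z).
Proof.
intros hh; rewrite minus_minus_swap, (minus_minus_swap x y u), (Rmult_comm q h).
replace (scal (h * q) z) with (scal h (scal q z)) by exact (scal_assoc _ _ _).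
rewrite scal_inv_minus by easy.
exact (f_equal (fun v => minus v _) (scal_minus_distr_l (/ h : R_AbsRing) _ _)).
Qed.

Lemma filterlim_minus {T : Type} {F : (T -> Prop) -> Prop} {FF : Filter F}
  (f g : T -> V) (x y : V) :
  filterlim f F (locally x) -> filterlim g F (locally y) ->
  filterlim (fun u => minus (f u) (g u)) F (locally (minus x y)).
Proof.
intros hf hg; exact (filterlim_comp_2 _ _ _ hf
  (filterlim_comp _ _ _ _ _ _ _ _ hg (filterlim_opp y)) (filterlim_plus x (opp y))).
Qed.

Lemma is_derive_quotient_right (F : R -> V) (b : R) (l : V) :
  is_derive F b l ->
  filterlim (fun h => scal (/ h) (minus (F (b + h)) (F b))) (at_right 0) (locally l).
Proof.
intros [_ hF]; specialize (hF b (fun P H => H)).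
apply filterlim_locally_ball_norm; intros eps.
(* The estimate given by differentiability is non-strict; half of [eps] makes the final one
   strict. *)
destruct (hF (pos_div_2 eps)) as [d hd].
exists d; intros h; change R in (type of h); intros hh h0.
assert (hb : ball b d (b + h)).
{ change (Rabs (b + h + - b) < d); change (Rabs (h + - 0) < d) in hh.
  now replace (b + h + - b) with (h + - 0) by ring. }
specialize (hd _ hb); cbn beta in hd.
assert (e : @minus R_AbsRing (b + h) b = h) by (change (b + h + - b = h); ring).
change (norm (minus (minus (F (b + h)) (F b)) (scal (@minus R_AbsRing (b + h) b) l)) <=
  eps / 2 * Rabs (@minus R_AbsRing (b + h) b)) in hd.
rewrite e, (Rabs_pos_eq h) in hd by lra.
unfold ball_norm.
apply Rle_lt_trans with (norm (scal (/ h) (minus (minus (F (b + h)) (F b)) (scal h l)))).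
- right; apply f_equal; symmetry; apply scal_inv_minus; lra.
- rewrite norm_scal_eq, Rabs_pos_eq by (left; now apply Rinv_0_lt_compat).
  apply Rle_lt_trans with (/ h * (eps / 2 * h)).
  + apply Rmult_le_compat_l; [left; now apply Rinv_0_lt_compat |].
    exact hd.
  + destruct eps as [r hr]; simpl; field_simplify; lra.
Qed.

Lemma is_RInt_linear (K : V -> V) (f : R -> V) (a b : R) (l : V) :
  is_linear K -> is_RInt f a b l -> is_RInt (fun r => K (f r)) a b (K l).
Proof.
intros hK hf; unfold is_RInt.
apply (filterlim_ext (fun ptd => K (scal (sign (b - a)) (Riemann_sum f ptd)))).
- intros s; rewrite linear_scal by easy; apply f_equal.
  induction s as [x0 | p s IH] using SF_cons_ind.
  + exact (linear_zero K hK).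
  + rewrite !Riemann_sum_cons, <- IH.
    eapply eq_trans; [exact (linear_plus K hK (scal (SF_h s - fst p) (f (snd p))) _) |].
    exact (f_equal (fun y => plus y _) (linear_scal K hK (SF_h s - fst p) (f (snd p)))).
- exact (filterlim_comp _ _ _ _ _ _ _ _ hf (linear_cont K l hK)).
Qed.

End RealModules.

Section UniformBoundedness.

Variables (V : CompleteNormedModule R_AbsRing) (I : Type) (U : I -> V -> V).

Hypothesis U_linear : forall i, is_linear (U i).

(** By homogeneity, a bound common to all [U i] on one ball would give a common operator bound. *)
Lemma unbounded_in_ball
  (hU : ~ exists M, forall i x, norm (U i x) <= M * norm x) (K r : R) :
  0 < r -> exists i (x : V), norm x <= r /\ K < norm (U i x).
Proof.
intros hr; apply NNPP; intros h; apply hU.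
exists (Rmax K 0 / r); intros i x.
destruct (Req_dec (norm x) 0) as [hx | hx].
- rewrite (norm_eq_zero _ hx), linear_zero, norm_zero by easy; lra.
- assert (h0 := norm_ge_0 x).
  assert (hxp : 0 < / norm x) by (apply Rinv_0_lt_compat; lra).
  apply Rnot_lt_le; intros hlt; apply h.
  exists i, (scal (r / norm x) x); rewrite (linear_scal _ (U_linear i)), !norm_scal_eq.
  rewrite Rabs_pos_eq by (apply Rmult_le_pos; lra); split.
  + right; field; lra.
  + apply Rle_lt_trans with (Rmax K 0); [apply Rmax_l |].
    apply (Rmult_lt_compat_l (r / norm x)) in hlt; [| apply Rmult_lt_0_compat; lra].
    now replace (r / norm x * (Rmax K 0 / r * norm x)) with (Rmax K 0) in hlt by (field; lra).
Qed.

(* The two points x + y, x - y replace Baire's theorem: U i is at least as large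
   at one of them as at y. *)
Lemma shrink_ball
  (hU : ~ exists M, forall i x, norm (U i x) <= M * norm x) (K r : R) (x : V) :
  0 < r -> exists (x' : V) r', 0 < r' <= r / 2 /\ norm (minus x' x) + r' <= r /\
    exists i, forall z : V, norm (minus z x') <= r' -> K < norm (U i z).
Proof.
intros hr.
destruct (unbounded_in_ball hU (K + 1) (r := r / 2)) as [i [y [hy hK]]]; [lra |].
assert (hx' : exists x' : V, norm (minus x' x) <= r / 2 /\ K + 1 < norm (U i x')).
{ assert (h := norm_plus_minus_max (U i x) (U i y)).
  revert h; rewrite <- linear_minus, <- linear_plus by easy.
  unfold Rmax; destruct (Rle_dec _ _); intros h.
  - exists (minus x y); split; [| exact (Rlt_le_trans _ _ _ hK h)].
    rewrite minus_minus_cancel; exact (Rle_trans _ _ _ (Req_le _ _ (norm_opp y)) hy).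
  - exists (plus x y); split; [| exact (Rlt_le_trans _ _ _ hK h)].
    replace (minus (plus x y) x) with y; [easy |].
    symmetry; exact (minus_plus_cancel x y). }
destruct hx' as [x' [hx' hK']].
destruct (linear_norm _ (U_linear i)) as [M [hM hMU]].
assert (hM' := Rinv_0_lt_compat M hM).
(* Within distance [/ M] of [x'] the value of [U i] moves by at most 1, the margin kept in [K + 1].
   The bound [r / 2] keeps the new ball inside the old one and makes the radii decay
   geometrically. *)
exists x', (Rmin (r / 2) (/ M)).
assert (hm1 := Rmin_l (r / 2) (/ M)); assert (hm2 := Rmin_r (r / 2) (/ M)).
split; [split; [apply Rmin_pos; lra | easy] |].
split; [lra |]; exists i; intros z hz.
assert (h1 : norm (U i (minus z x')) <= 1).
{ apply Rle_trans with (1 := hMU _).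
  apply Rle_trans with (M * / M); [apply Rmult_le_compat_l; lra |].
  right; apply Rinv_r; lra. }
assert (h2 : norm (U i x') <= norm (U i (minus z x')) + norm (U i z)).
{ rewrite linear_minus, norm_minus_sym by easy.
  rewrite Rplus_comm; eapply Rle_trans; [| apply norm_triangle].
  right; apply f_equal; symmetry; exact (plus_minus_cancel (U i z) (U i x')). }
lra.
Qed.

Theorem uniform_boundedness :
  (forall x, exists M, forall i, norm (U i x) <= M) ->
  exists M, forall i x, norm (U i x) <= M * norm x.
Proof.
intros hb; apply NNPP; intros hU.
(* A pair is a ball, given by center and radius. Guarding [P] by a positive radius makes a successor
   exist for every pair, so that it can be chosen by a total function. *)
pose (P := fun (k : nat) (s s' : V * R) => 0 < snd s ->
  0 < snd s' <= snd s / 2 /\ norm (minus (fst s') (fst s)) + snd s' <= snd s /\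
  exists i, forall z : V, norm (minus z (fst s')) <= snd s' -> INR k < norm (U i z)).
assert (hP : forall k s, exists s', P k s s').
{ intros k [x r]; destruct (Rlt_dec 0 r) as [hr | hr].
  - destruct (shrink_ball hU (INR k) x hr) as [x' [r' h]]; now exists (x', r').
  - now exists (x, r). }
pose (step := fun k s => proj1_sig (constructive_indefinite_description _ (hP k s))).
assert (hstep : forall k s, P k s (step k s)).
{ intros k s; exact (proj2_sig (constructive_indefinite_description _ (hP k s))). }
pose (u := fix u n := match n with O => (zero : V, 1) | S m => step m (u m) end).
assert (hu0 : forall n, 0 < snd (u n)).
{ intros n; induction n as [|n IH]; [simpl; lra | now apply (hstep n (u n))]. }
assert (hu : forall n, P n (u n) (u (S n))) by (intros n; apply hstep).
assert (hur : forall n, snd (u n) <= (/ 2) ^ n).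
{ intros n; induction n as [|n IH]; [simpl; lra |].
  destruct (hu n (hu0 n)) as [[_ h] _]; simpl pow; lra. }
(* Nesting of balls in a form that telescopes. It makes the centers Cauchy and puts their limit in
   every ball, where some [U i] exceeds k, for each k. *)
assert (hud : forall n k,
  norm (minus (fst (u (n + k)%nat)) (fst (u n))) + snd (u (n + k)%nat) <= snd (u n)).
{ intros n k; induction k as [|k IH].
  - rewrite Nat.add_0_r, norm_minus_diag; lra.
  - rewrite Nat.add_succ_r; destruct (hu _ (hu0 (n + k)%nat)) as [_ [h _]].
    assert (hadd : forall a b c d e f, a <= b + c -> b + d <= e -> c + e <= f -> a + d <= f)
      by (intros; lra).
    exact (hadd _ _ _ _ _ _ (norm_minus_triangle _ _ _) h IH). }
assert (hlim : exists y : V, filterlim (fun n => fst (u n)) eventually (locally y)).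
{ apply (filterlim_locally_cauchy (U := V) (F := eventually)).
  intros eps.
  destruct (pow_lt_1_zero (/ 2) ltac:(rewrite Rabs_pos_eq; lra) (eps / 2)
    ltac:(destruct eps; simpl; lra)) as [N hN].
  exists (fun n => (N <= n)%nat); split; [now exists N |].
  intros n m hn hm; refine (norm_compat1 (V := V) _ _ _ _).
  apply Rle_lt_trans with (1 := norm_minus_triangle _ (fst (u N)) _).
  rewrite (norm_minus_sym (fst (u N))).
  specialize (hN N (le_n N)); apply Rabs_def2 in hN.
  assert (h1 := hud N (n - N)%nat); assert (h2 := hud N (m - N)%nat).
  replace (N + (n - N))%nat with n in h1 by lia.
  replace (N + (m - N))%nat with m in h2 by lia.
  assert (hadd : forall a b c d e p q, a + c <= e -> b + d <= e -> 0 < c -> 0 < d ->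
    e <= p -> p < q / 2 -> b + a < q) by (intros; lra).
  exact (hadd _ _ _ _ _ _ _ h1 h2 (hu0 n) (hu0 m) (hur N) (proj1 hN)). }
destruct hlim as [y hy].
assert (hyu : forall n, norm (minus y (fst (u n))) <= snd (u n)).
{ intros n.
  apply (closed_filterlim_loc (F := eventually)
    (fun m => norm (minus (fst (u m)) (fst (u n)))) (fun r => r <= snd (u n))).
  - apply (filterlim_comp _ _ _ _ norm _ _ _
      (filterlim_comp_2 _ _ _ hy (filterlim_const (opp (fst (u n)))) (filterlim_plus _ _))
      (filterlim_norm _)).
  - exists n; intros m hm; assert (h := hud n (m - n)%nat).
    replace (n + (m - n))%nat with m in h by lia; assert (h' := hu0 m); lra.
  - apply closed_le. }
destruct (hb y) as [M hM]; destruct (INR_unbounded M) as [k hk].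
destruct (hu k (hu0 k)) as [_ [_ [i hi]]].
specialize (hi y (hyu (S k))); specialize (hM i); lra.
Qed.

End UniformBoundedness.

(** * Orbit integrals of a strongly continuous semigroup *)

Section RealSemigroup.

Variable V : CompleteNormedModule R_AbsRing.
Let W : NormedModule R_AbsRing := V.
Variable S : R -> W -> W.

Hypothesis S_linear : forall t, 0 <= t -> is_linear (S t).
Hypothesis S_zero : forall x, S 0 x = x.
Hypothesis S_add : forall s t, 0 <= s -> 0 <= t -> forall x, S (s + t) x = S s (S t x).
Hypothesis S_cont : forall x, filterlim (fun t => S t x) (at_right 0) (locally x).

Lemma semigroup_near_zero (x : W) (eps : posreal) :
  exists d, 0 < d /\ forall h, 0 <= h < d -> norm (minus (S h x) x) < eps.
Proof.
assert (h := S_cont (x := x)).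
apply (proj1 (filterlim_locally_ball_norm _ _)) with (eps := eps) in h.
destruct h as [[d hd] h]; exists d; split; [easy |]; intros k [hk0 hk].
destruct hk0 as [hk0 | <-].
- apply h; [| easy]; change (Rabs (k + - 0) < d); rewrite Rabs_pos_eq; lra.
- rewrite S_zero, norm_minus_diag; apply cond_pos.
Qed.

(** Otherwise there are times s_n tending to 0 at which the operator bound n fails. But S(s_n) x
    tends to x for each x, so these operators are pointwise bounded, against uniform boundedness. *)
Lemma semigroup_bounded_near_zero :
  exists d M, 0 < d /\ 0 <= M /\
    forall s x, 0 <= s <= d -> norm (S s x) <= M * norm x.
Proof.
apply NNPP; intros hn.
assert (h : forall n, exists s, 0 <= s <= / (INR n + 1) /\
  exists x, INR n * norm x < norm (S s x)).
{ intros n; apply NNPP; intros hn'; apply hn; assert (hn0 := pos_INR n).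
  exists (/ (INR n + 1)), (INR n); split; [apply Rinv_0_lt_compat; lra |].
  split; [easy |]; intros s x hs; apply Rnot_lt_le; intros hlt; apply hn'.
  exists s; split; [easy | now exists x]. }
pose (s := fun n => proj1_sig (constructive_indefinite_description _ (h n))).
assert (hs : forall n, 0 <= s n <= / (INR n + 1) /\ exists x, INR n * norm x < norm (S (s n) x)).
{ intros n; exact (proj2_sig (constructive_indefinite_description _ (h n))). }
destruct (@uniform_boundedness V nat (fun n => S (s n))) as [M hM].
- intros n; apply S_linear, hs.
- intros x.
  assert (hx : exists y : W, filterlim (fun n => S (s n) x) eventually (locally y)).
  { exists x; apply filterlim_locally_ball_norm; intros eps.
    destruct (semigroup_near_zero x eps) as [d [hd hd']].
    destruct (INR_unbounded (/ d)) as [N hN].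
    exists N; intros n hn'; apply hd'; split; [apply hs |].
    apply Rle_lt_trans with (1 := proj2 (proj1 (hs n))).
    rewrite <- (Rinv_inv d); apply Rinv_lt_contravar.
    - apply Rmult_lt_0_compat; [now apply Rinv_0_lt_compat |].
      assert (h0 := pos_INR n); lra.
    - apply le_INR in hn'; lra. }
  destruct (filterlim_bounded _ hx) as [M hM]; now exists M.
- destruct (INR_unbounded M) as [n hn']; destruct (hs n) as [_ [x hx]].
  apply (Rlt_irrefl (norm (S (s n) x))).
  apply Rle_lt_trans with (1 := hM n x).
  apply Rle_lt_trans with (2 := hx).
  apply Rmult_le_compat_r; [apply norm_ge_0 | lra].
Qed.

Lemma semigroup_bounded (a : R) :
  exists M, 0 <= M /\ forall s x, 0 <= s <= a -> norm (S s x) <= M * norm x.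
Proof.
destruct semigroup_bounded_near_zero as [d [M [hd [hM h]]]].
(* With base [M + 1], at least 1, the bounds increase with n, so the one for [0, n d] remains valid
   in the next step. *)
assert (hn : forall n s x, 0 <= s <= INR n * d -> norm (S s x) <= (M + 1) ^ n * norm x).
{ intros n; induction n as [|n IH]; intros s x hs.
  - simpl in hs; replace s with 0 by lra; rewrite S_zero; simpl; lra.
  - rewrite S_INR in hs; destruct (Rle_dec s (INR n * d)) as [hs' | hs'].
    + apply Rle_trans with (1 := IH s x (conj (proj1 hs) hs')).
      apply Rmult_le_compat_r; [apply norm_ge_0 |].
      simpl; rewrite <- (Rmult_1_l ((M + 1) ^ n)) at 1.
      apply Rmult_le_compat_r; [apply pow_le |]; lra.
    + assert (h0 := Rmult_le_pos _ _ (pos_INR n) (Rlt_le _ _ hd)).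
      replace s with ((s - INR n * d) + INR n * d) by ring.
      rewrite S_add by lra.
      assert (h1 : norm (S (s - INR n * d) (S (INR n * d) x)) <= M * norm (S (INR n * d) x))
        by (apply h; lra).
      assert (h2 : norm (S (INR n * d) x) <= (M + 1) ^ n * norm x) by (apply IH; lra).
      assert (h3 := norm_ge_0 (S (INR n * d) x)).
      simpl; nra. }
destruct (INR_unbounded (a / d)) as [n hna].
exists ((M + 1) ^ n); split; [apply pow_le; lra |].
intros s x hs; apply hn; split; [easy |].
apply (Rmult_lt_compat_r d) in hna; [| easy].
unfold Rdiv in hna; rewrite Rmult_assoc, Rinv_l in hna; lra.
Qed.

(** Factoring out the operator at the smaller time, bounded uniformly up to b, reduces continuity
    from both sides to right-continuity at 0. *)
Lemma orbit_lipschitz (b : R) : exists M, 0 <= M /\ forall s s' x,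
  0 <= s <= s' -> s <= b -> norm (minus (S s' x) (S s x)) <= M * norm (minus (S (s' - s) x) x).
Proof.
destruct (semigroup_bounded b) as [M [hM h]]; exists M; split; [easy |].
intros s s' x hs hb.
replace s' with (s + (s' - s)) at 1 by ring.
rewrite S_add, <- linear_minus by (try apply S_linear; lra); apply h; lra.
Qed.

Lemma orbit_continuous (x : W) (r : R) :
  continuous (fun r => S (Rmax 0 r) x) r.
Proof.
destruct (orbit_lipschitz (Rmax 0 r + 1)) as [M [hM h]].
apply filterlim_locally_ball_norm; intros eps.
assert (he : 0 < eps / (M + 1)) by (apply Rdiv_lt_0_compat; [apply cond_pos | lra]).
destruct (semigroup_near_zero x (mkposreal _ he)) as [d [hd hd']]; simpl in hd'.
assert (hd1 : 0 < Rmin d 1) by (apply Rmin_pos; lra).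
exists (mkposreal _ hd1); intros s; change R in (type of s); intros hs.
change (Rabs (s + - r) < Rmin d 1) in hs.
assert (hmin1 := Rmin_l d 1); assert (hmin2 := Rmin_r d 1).
assert (hm : Rabs (Rmax 0 s - Rmax 0 r) < Rmin d 1).
{ apply Rle_lt_trans with (2 := hs); unfold Rmax, Rabs.
  repeat destruct (Rle_dec _ _); repeat destruct (Rcase_abs _); lra. }
apply Rabs_def2 in hm.
assert (hM1 : forall k, 0 <= k < d -> M * norm (minus (S k x) x) < eps).
{ intros k hk; apply Rle_lt_trans with (M * (eps / (M + 1))).
  - apply Rmult_le_compat_l; [easy | left; now apply hd'].
  - rewrite <- (Rmult_1_r eps) at 2; unfold Rdiv.
    replace (M * (eps * / (M + 1))) with (eps * (M / (M + 1))) by (field; lra).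
    apply Rmult_lt_compat_l; [apply cond_pos |].
    apply (Rmult_lt_reg_r (M + 1)); [lra |]; unfold Rdiv; rewrite Rmult_assoc, Rinv_l; lra. }
assert (h0 := Rmax_l 0 s); assert (h0' := Rmax_l 0 r).
unfold ball_norm; destruct (Rle_dec (Rmax 0 r) (Rmax 0 s)) as [hle | hle].
- apply Rle_lt_trans with (1 := h (Rmax 0 r) (Rmax 0 s) x (conj h0' hle) ltac:(lra)).
  apply hM1; lra.
- rewrite norm_minus_sym.
  apply Rle_lt_trans with (1 := h (Rmax 0 s) (Rmax 0 r) x ltac:(lra) ltac:(lra)).
  apply hM1; lra.
Qed.

(* The truncation [Rmax 0 r] makes the integrand continuous on the whole line. *)
Definition weighted_orbit (p q : R) (x : W) (r : R) : W :=
  scal (p + q * r) (S (Rmax 0 r) x).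

Definition orbit_integral (p q a : R) (x : W) : W :=
  RInt (V := V) (weighted_orbit p q x) 0 a.

Lemma weighted_orbit_continuous (p q : R) (x : W) (r : R) :
  continuous (weighted_orbit p q x) r.
Proof.
apply (continuous_scal (fun r : R => p + q * r) (fun r => S (Rmax 0 r) x)).
- apply (ex_derive_continuous (fun r : R => p + q * r)); auto_derive; easy.
- apply orbit_continuous.
Qed.

Lemma ex_RInt_weighted_orbit (p q : R) (x : W) (a b : R) :
  ex_RInt (weighted_orbit p q x) a b.
Proof.
apply (ex_RInt_continuous (V := V)); intros; apply weighted_orbit_continuous.
Qed.

Lemma is_RInt_weighted_orbit (p q : R) (x : W) (a : R) :
  is_RInt (weighted_orbit p q x) 0 a (orbit_integral p q a x).
Proof. apply (RInt_correct (V := V)), ex_RInt_weighted_orbit. Qed.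

Lemma is_derive_orbit_integral (p q : R) (x : W) (a : R) :
  is_derive (fun b => orbit_integral p q b x) a (weighted_orbit p q x a).
Proof.
apply is_derive_RInt with (a := 0).
- apply filter_forall; intros b; apply is_RInt_weighted_orbit.
- apply weighted_orbit_continuous.
Qed.

(** K will be an operator S(t) or, to recover complex homogeneity, multiplication by a complex
    scalar. *)
Lemma orbit_integral_commute (K : W -> W) (p q a : R) (x : W) :
  is_linear K -> (forall t y, 0 <= t -> K (S t y) = S t (K y)) ->
  K (orbit_integral p q a x) = orbit_integral p q a (K x).
Proof.
intros hK hKS; symmetry; apply (is_RInt_unique (V := V)).
apply (is_RInt_ext (fun r => K (weighted_orbit p q x r))).
- intros r _; unfold weighted_orbit.
  rewrite <- hKS by apply Rmax_l; exact (linear_scal K hK _ _).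
- apply is_RInt_linear; [easy | apply is_RInt_weighted_orbit].
Qed.

Lemma orbit_integral_linear (p q a : R) :
  0 <= a -> is_linear (orbit_integral p q a).
Proof.
intros ha; split.
- intros x y; apply (is_RInt_unique (V := V)).
  apply (is_RInt_ext (fun r => plus (weighted_orbit p q x r) (weighted_orbit p q y r))).
  + intros r _; unfold weighted_orbit.
    rewrite (linear_plus _ (S_linear (Rmax_l 0 r))); symmetry.
    exact (scal_distr_l (p + q * r : R_AbsRing) _ _).
  + apply (is_RInt_plus (V := W)); apply is_RInt_weighted_orbit.
- intros k x; apply (is_RInt_unique (V := V)).
  apply (is_RInt_ext (fun r => scal k (weighted_orbit p q x r))).
  + intros r _; unfold weighted_orbit.
    rewrite (linear_scal _ (S_linear (Rmax_l 0 r))), !scal_assoc.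
    apply (f_equal (fun c => scal c _)), Rmult_comm.
  + apply (is_RInt_scal (V := W)); apply is_RInt_weighted_orbit.
- destruct (semigroup_bounded a) as [M [hM h]].
  (* This bounds the weight on [0, a]. The [+ 1] in the operator bound below makes it positive, as
     [is_linear] demands. *)
  pose (C := Rabs p + Rabs q * a).
  assert (hC : 0 <= C).
  { apply Rplus_le_le_0_compat; [| apply Rmult_le_pos]; try apply Rabs_pos; easy. }
  assert (hCM := Rmult_le_pos _ _ ha (Rmult_le_pos _ _ hC hM)).
  exists (a * (C * M) + 1); split; [lra |]; intros x.
  apply Rle_trans with ((a - 0) * (C * (M * norm x))).
  + apply (norm_RInt_le_const (weighted_orbit p q x)); [easy | | apply is_RInt_weighted_orbit].
    intros r hr; unfold weighted_orbit; rewrite norm_scal_eq, (Rmax_right 0 r) by easy.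
    apply Rmult_le_compat; [apply Rabs_pos | apply norm_ge_0 | | now apply h].
    apply Rle_trans with (1 := Rabs_triang _ _); apply Rplus_le_compat_l.
    rewrite Rabs_mult, (Rabs_pos_eq r) by easy.
    apply Rmult_le_compat_l; [apply Rabs_pos | easy].
  + assert (hx := norm_ge_0 x); nra.
Qed.

Definition real_generator (x y : W) : Prop :=
  filterlim (fun h => scal (/ h) (minus (S h x) x)) (at_right 0) (locally y).

Lemma real_generator_commute (K : W -> W) (x y : W) :
  is_linear K -> (forall t z, 0 <= t -> K (S t z) = S t (K z)) ->
  real_generator x y -> real_generator (K x) (K y).
Proof.
intros hK hKS hxy.
apply (filterlim_ext_loc (fun h => K (scal (/ h) (minus (S h x) x)))).
- exists (mkposreal 1 Rlt_0_1); intros h _ hh.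
  rewrite (linear_scal _ hK), linear_minus, hKS by (easy || now apply Rlt_le); easy.
- exact (filterlim_comp _ _ _ _ _ _ _ _ hxy (linear_cont K y hK)).
Qed.

Lemma orbit_integral_point (p q : R) (x : W) : orbit_integral p q 0 x = zero.
Proof. exact (RInt_point (V := V) 0 (weighted_orbit p q x)). Qed.

Lemma is_RInt_weighted_orbit_diff (p q : R) (x : W) (a b : R) :
  is_RInt (weighted_orbit p q x) a b (minus (orbit_integral p q b x) (orbit_integral p q a x)).
Proof.
unfold minus; rewrite plus_comm.
apply (is_RInt_Chasles (V := W)) with (b := 0).
- apply (is_RInt_swap (V := W)), is_RInt_weighted_orbit.
- apply is_RInt_weighted_orbit.
Qed.

(** Substituting r + h for r turns the weight p + q r into p + q r - q h. Affine weights are thus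
    stable up to a multiple of the constant weight 1, whence the correction by integrals with p = 1,
    q = 0. *)
Lemma semigroup_orbit_integral (p q a h : R) (x : W) : 0 <= a -> 0 <= h ->
  S h (orbit_integral p q a x) =
  minus (minus (orbit_integral p q (a + h) x) (orbit_integral p q h x))
    (scal (q * h) (minus (orbit_integral 1 0 (a + h) x) (orbit_integral 1 0 h x))).
Proof.
intros ha hh.
assert (hi : is_RInt (fun r => S h (weighted_orbit p q x r)) 0 a (S h (orbit_integral p q a x)))
  by (apply is_RInt_linear; [now apply S_linear | apply is_RInt_weighted_orbit]).
rewrite <- (is_RInt_unique (V := V) _ _ _ _ hi).
apply (is_RInt_unique (V := V)).
pose (g := (fun r => minus (weighted_orbit p q x r)
  (scal (q * h) (weighted_orbit 1 0 x r))) : R -> W).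
(* The redundant factors 1 match the form of a linear change of variable in [is_RInt_comp_lin]. *)
apply (is_RInt_ext (fun r => scal 1 (g (1 * r + h)))).
- intros r [hr _]; rewrite Rmin_left in hr by easy.
  eapply eq_trans; [exact (scal_R1 (g (1 * r + h))) |].
  unfold g, weighted_orbit; rewrite (linear_scal _ (S_linear hh)).
  rewrite !Rmax_right, <- S_add by lra.
  replace (h + r) with (1 * r + h) by ring.
  rewrite scal_assoc.
  eapply eq_trans; [symmetry; exact (scal_minus_distr_r (p + q * (1 * r + h) : R_AbsRing)
    (q * h * (1 + 0 * (1 * r + h)) : R_AbsRing) (S (1 * r + h) x)) |].
  apply (f_equal (fun c => scal c _)).
  change (p + q * (1 * r + h) + - (q * h * (1 + 0 * (1 * r + h))) = p + q * r); ring.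
- apply (is_RInt_comp_lin (V := W)).
  replace (1 * 0 + h) with h by ring; replace (1 * a + h) with (a + h) by ring.
  apply (is_RInt_minus (V := W)); [| apply (is_RInt_scal (V := W))];
    apply is_RInt_weighted_orbit_diff.
Qed.

Lemma orbit_integral_right_continuous (p q : R) (x : W) (a : R) :
  filterlim (fun h => orbit_integral p q (a + h) x) (at_right 0)
    (locally (orbit_integral p q a x)).
Proof.
apply (filterlim_filter_le_1 (F := locally 0)); [apply filter_le_within |].
replace (orbit_integral p q a x) with (orbit_integral p q (a + 0) x) by now rewrite Rplus_0_r.
apply (continuous_comp (fun h : R => a + h) (fun b => orbit_integral p q b x)).
- apply (ex_derive_continuous (fun h : R => a + h)); auto_derive; easy.
- apply (ex_derive_continuous (V := W)); eexists; apply is_derive_orbit_integral.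
Qed.

(* Integration by parts: the last term comes from the derivative q of the weight. *)
Lemma real_generator_orbit_integral (p q a : R) (x : W) : 0 <= a ->
  real_generator (orbit_integral p q a x)
    (minus (minus (scal (p + q * a) (S a x)) (scal p x)) (scal q (orbit_integral 1 0 a x))).
Proof.
intros ha.
assert (hd : forall b, filterlim
  (fun h => scal (/ h) (minus (orbit_integral p q (b + h) x) (orbit_integral p q b x)))
  (at_right 0) (locally (weighted_orbit p q x b)))
  by (intros b; apply (is_derive_quotient_right (is_derive_orbit_integral p q x b))).
assert (hl := filterlim_minus (filterlim_minus (hd a) (hd 0)) (filterlim_comp _ _ _ _ _ _ _ _
  (filterlim_minus (@orbit_integral_right_continuous 1 0 x a)
    (@orbit_integral_right_continuous 1 0 x 0)) (filterlim_scal_r (V := W) q _))).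
unfold weighted_orbit in hl.
rewrite Rmult_0_r, Rplus_0_r, (orbit_integral_point p q), (orbit_integral_point 1 0) in hl.
rewrite (Rmax_right 0 a), (Rmax_left 0 0), S_zero in hl by lra.
rewrite <- (minus_zero_r (orbit_integral 1 0 a x)).
revert hl; apply filterlim_ext_loc.
exists (mkposreal 1 Rlt_0_1); intros h _ hh.
rewrite semigroup_orbit_integral, Rplus_0_l by lra.
symmetry; eapply eq_trans; [apply scal_inv_quotient; lra |].
refine (f_equal (fun v : W => minus (minus _ (scal (/ h) v) : W) _) (eq_sym _)).
exact (minus_zero_r (orbit_integral p q h x)).
Qed.

(** Describes the graph by equations continuous in (x, y), which will make it closed. Forwards, the
    integral operator J_h commutes with the generator, so J_h y is its value at J_h x, which is also
    S(h) x - x; limits are unique. Backwards, divide by h and differentiate the integral at 0. *)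
Lemma real_generator_iff (x y : W) :
  real_generator x y <-> forall h, 0 <= h -> orbit_integral 1 0 h y = minus (S h x) x.
Proof.
assert (hJ : forall h z, 0 <= h -> real_generator (orbit_integral 1 0 h z) (minus (S h z) z)).
{ intros h z hh; assert (hg := @real_generator_orbit_integral 1 0 h z hh).
  rewrite Rmult_0_l, Rplus_0_r, !scal_R1, scal_R0 in hg.
  exact (eq_ind _ _ hg _ (minus_zero_r (minus (S h z) z))). }
split.
- intros hxy h hh.
  apply (filterlim_locally_unique (V := W) (F := at_right 0)
    (fun k => scal (/ k) (minus (S k (orbit_integral 1 0 h x)) (orbit_integral 1 0 h x)))).
  + apply real_generator_commute; [now apply orbit_integral_linear | | easy].
    intros t z ht; symmetry; apply orbit_integral_commute; [now apply S_linear |].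
    intros s w hs; rewrite <- !S_add by easy; now rewrite Rplus_comm.
  + now apply hJ.
- intros h.
  assert (hd := is_derive_quotient_right (is_derive_orbit_integral 1 0 y 0)).
  cbn beta in hd; rewrite orbit_integral_point in hd.
  unfold weighted_orbit in hd.
  rewrite Rmax_left, S_zero, Rmult_0_l, Rplus_0_r, scal_R1 in hd by lra.
  revert hd; apply filterlim_ext_loc.
  exists (mkposreal 1 Rlt_0_1); intros k _ hk.
  rewrite Rplus_0_l, <- h by lra.
  exact (f_equal (scal (/ k)) (minus_zero_r (orbit_integral 1 0 k y))).
Qed.

Lemma orbit_integral_semigroup (p q a t : R) (x : W) : 0 <= t ->
  orbit_integral p q a (S t x) = S t (orbit_integral p q a x).
Proof.
intros ht; symmetry; apply orbit_integral_commute; [now apply S_linear |].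
intros s w hs; rewrite <- !S_add by easy; now rewrite Rplus_comm.
Qed.

End RealSemigroup.

(** * Complex scalars and rescaling *)

Section RestrictScalars.

Variable X : CompleteNormedModule C_AbsRing.

(* X with scalars restricted to R, same norm and same topology, so that the
   integral RInt of real normed modules applies to X-valued functions. *)
Definition real_scal (a : R) (x : X) : X := scal (RtoC a : C_AbsRing) x.

Definition real_ModuleSpace_mixin :
  ModuleSpace.mixin_of R_Ring (CompleteNormedModule.AbelianGroup _ X).
Proof.
apply (@ModuleSpace.Mixin R_Ring (CompleteNormedModule.AbelianGroup _ X) real_scal);
  intros; unfold real_scal.
- eapply eq_trans; [exact (scal_assoc (RtoC x : C_AbsRing) (RtoC y : C_AbsRing) u) |].
  exact (f_equal (fun c : C_AbsRing => scal c u) (eq_sym (RtoC_mult x y))).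
- exact (scal_one (u : X)).
- exact (scal_distr_l (RtoC x : C_AbsRing) u v).
- eapply eq_trans; [exact (f_equal (fun c : C_AbsRing => scal c u) (RtoC_plus x y)) |].
  exact (scal_distr_r (RtoC x : C_AbsRing) (RtoC y : C_AbsRing) (u : X)).
Defined.

(** The group and uniform structures are reused from X itself, so that limits over the two scalar
    fields are convertible statements. *)
Definition real_NormedModuleAux : NormedModuleAux R_AbsRing :=
  NormedModuleAux.Pack R_AbsRing X
    (NormedModuleAux.Class R_AbsRing X
      (ModuleSpace.Class R_Ring X (AbelianGroup.class (CompleteNormedModule.AbelianGroup _ X))
        real_ModuleSpace_mixin)
      (UniformSpace.class (CompleteNormedModule.UniformSpace _ X))) X.

Definition real_NormedModule_mixin : NormedModule.mixin_of R_AbsRing real_NormedModuleAux.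
Proof.
apply (@NormedModule.Mixin R_AbsRing real_NormedModuleAux (fun x : X => norm x)
  (@norm_factor C_AbsRing X)).
- exact (@norm_triangle C_AbsRing X).
- intros a x; change (norm (real_scal a x) <= Rabs a * norm (x : X)).
  rewrite <- Cmod_R; exact (norm_scal (RtoC a : C_AbsRing) (x : X)).
- exact (@norm_compat1 C_AbsRing X).
- exact (@norm_compat2 C_AbsRing X).
- exact (@norm_eq_zero C_AbsRing X).
Defined.

Definition real_module : CompleteNormedModule R_AbsRing :=
  CompleteNormedModule.Pack R_AbsRing X
    (CompleteNormedModule.Class R_AbsRing X
      (NormedModule.Class R_AbsRing X (NormedModuleAux.class R_AbsRing real_NormedModuleAux)
        real_NormedModule_mixin)
      (CompleteNormedModule.mixin _ X (CompleteNormedModule.class _ X))) X.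

Let Y : NormedModule R_AbsRing := real_module.

Lemma is_linear_real (l : X -> X) : is_linear l -> is_linear (U := Y) (V := Y) l.
Proof.
intros [hp hs hn]; split; [exact hp | | exact hn].
intros k x; exact (hs (RtoC k) x).
Qed.

Lemma is_linear_complex (l : X -> X) :
  is_linear (U := Y) (V := Y) l -> (forall (a : C_AbsRing) x, l (scal a x) = scal a (l x)) ->
  is_linear l.
Proof. intros [hp _ hn] hs; split; [exact hp | exact hs | exact hn]. Qed.

Lemma is_linear_homothety (a : C_AbsRing) : is_linear (fun x : X => scal a x).
Proof.
split.
- intros x y; exact (scal_distr_l a x y).
- intros k x; apply scal_comm.
- exists (abs a + 1); assert (h := abs_ge_0 a); split; [lra |]; intros x.
  apply Rle_trans with (1 := norm_scal a x).
  apply Rmult_le_compat_r; [apply norm_ge_0 | lra].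
Qed.

End RestrictScalars.

Section ComplexExponential.

Lemma Cexp_zero : Cexp 0 = 1.
Proof.
unfold Cexp; simpl; rewrite exp_0, cos_0, sin_0.
apply injective_projections; simpl; ring.
Qed.

Lemma Cexp_plus (z w : C) : Cexp (z + w) = (Cexp z * Cexp w)%C.
Proof.
unfold Cexp; simpl; rewrite exp_plus, cos_plus, sin_plus.
apply injective_projections; simpl; unfold Re, Im; ring.
Qed.

Lemma Cexp_opp_l (z : C) : (Cexp z * Cexp (- z))%C = 1.
Proof. rewrite <- Cexp_plus, Cplus_opp_r; apply Cexp_zero. Qed.

(** Taken coordinatewise: the real and imaginary parts of e^(k h) have derivatives Re k and Im k at
    0. [locally_C] translates between modulus neighborhoods and product neighborhoods. *)
Lemma Cexp_derive_right (k : C) :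
  filterlim (fun h : R => (RtoC (/ h) * (Cexp (k * RtoC h) - 1))%C : C_AbsRing) (at_right 0)
    (locally (k : C_AbsRing)).
Proof.
destruct k as [a b].
assert (h1 : is_derive (V := R_NormedModule) (fun h : R => exp (a * h) * cos (b * h)) 0 a)
  by (auto_derive; [easy |]; rewrite !Rmult_0_r, exp_0, cos_0, sin_0; ring).
assert (h2 : is_derive (V := R_NormedModule) (fun h : R => exp (a * h) * sin (b * h)) 0 b)
  by (auto_derive; [easy |]; rewrite !Rmult_0_r, exp_0, cos_0, sin_0; ring).
apply is_derive_quotient_right in h1; apply is_derive_quotient_right in h2.
intros P hP; apply locally_C in hP; destruct hP as [eps hP].
apply (fun h => proj1 (filterlim_locally (U := R_UniformSpace) (F := at_right 0) _ a) h eps) in h1.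
apply (fun h => proj1 (filterlim_locally (U := R_UniformSpace) (F := at_right 0) _ b) h eps) in h2.
unfold filtermap; generalize (filter_and _ _ h1 h2); apply filter_imp; intros h [hb1 hb2].
apply hP; change (R) in (type of h).
replace (RtoC (/ h) * (Cexp ((a, b) * RtoC h) - 1))%C with
  ((/ h * (exp (a * (0 + h)) * cos (b * (0 + h)) - exp (a * 0) * cos (b * 0)),
    / h * (exp (a * (0 + h)) * sin (b * (0 + h)) - exp (a * 0) * sin (b * 0))) : C).
- split; [exact hb1 | exact hb2].
- rewrite !Rmult_0_r, exp_0, cos_0, sin_0, Rplus_0_l.
  unfold Cexp; apply injective_projections; simpl;
    replace (a * h - b * 0) with (a * h) by ring;
    replace (a * 0 + b * h) with (b * h) by ring; ring.
Qed.

Lemma Cexp_right_continuous (k : C) :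
  filterlim (fun h : R => Cexp (k * RtoC h) : C_AbsRing) (at_right 0) (locally (one : C_AbsRing)).
Proof.
assert (h0 : filterlim (fun h : R => RtoC h : C_AbsRing) (at_right 0) (locally (zero : C_AbsRing))).
{ intros P hP; apply locally_C in hP; destruct hP as [eps hP]; exists eps; intros h hh _.
  apply hP; split; [exact hh | apply ball_center]. }
assert (h := filterlim_comp_2 _ _ _ (filterlim_comp_2 _ _ _ h0 (@Cexp_derive_right k)
    (filterlim_mult (K := C_AbsRing) _ _))
  (filterlim_const (one : C_AbsRing)) (filterlim_plus (V := AbsRing_NormedModule C_AbsRing) _ _)).
replace (one : C_AbsRing) with (plus (mult zero (k : C_AbsRing)) one : C_AbsRing)
  by (change ((0 * k + 1)%C = 1); ring).
revert h; apply filterlim_ext_loc.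
exists (mkposreal 1 Rlt_0_1); intros h _ hh; change (R) in (type of h).
change ((RtoC h * (RtoC (/ h) * (Cexp (k * RtoC h) - 1)) + 1)%C = Cexp (k * RtoC h)).
rewrite Cmult_assoc, <- RtoC_mult, Rinv_r, Cmult_1_l by lra; ring.
Qed.

End ComplexExponential.

Section ModuleIdentities.

Variables (K : Ring) (M : ModuleSpace K).
Implicit Types x y z : M.

(** Simplifies the value of the generator at an orbit integral for the weight of J (p = 1, q = 0);
    the next lemma does so for G, whose weight vanishes at t. *)
Lemma minus_scal_one_zero x y z :
  minus (minus (scal one x) (scal one y)) (scal zero z) = minus x y.
Proof.
rewrite !scal_one, scal_zero_l.
exact (eq_trans (f_equal (plus (minus x y)) opp_zero) (plus_zero_r (minus x y))).
Qed.

Lemma minus_scal_zero_opp (k : K) x y z :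
  minus (minus (scal zero x) (scal one y)) (scal (opp k) z) = minus (scal k z) y.
Proof.
rewrite scal_zero_l, scal_one, scal_opp_l.
exact (minus_zero_minus_opp y (scal k z)).
Qed.

End ModuleIdentities.

(** * The rescaled semigroup, its generator -B and its orbit integrals *)

Section RescaledSemigroup.

Variables (X : CompleteNormedModule C_AbsRing) (T : C0_semigroup X) (lambda : C).

Definition rescaled (r : R) (x : X) : X :=
  scal (Cexp (- lambda * RtoC r)%C : C_AbsRing) (T r x).

Lemma Cscal_assoc (a b : C) (x : X) :
  scal (a : C_AbsRing) (scal (b : C_AbsRing) x) = scal ((a * b)%C : C_AbsRing) x.
Proof. exact (scal_assoc (a : C_AbsRing) (b : C_AbsRing) x). Qed.

Lemma rescaled_linear (r : R) : 0 <= r -> is_linear (rescaled r).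
Proof.
intros hr; exact (is_linear_comp _ _ (semigroup_linear T hr) (@is_linear_homothety X _)).
Qed.

Lemma rescaled_zero (x : X) : rescaled 0 x = x.
Proof.
unfold rescaled; rewrite semigroup_zero, Cmult_0_r, Cexp_zero; exact (scal_one x).
Qed.

Lemma rescaled_add (s t : R) (x : X) : 0 <= s -> 0 <= t ->
  rescaled (s + t) x = rescaled s (rescaled t x).
Proof.
intros hs ht; unfold rescaled; rewrite semigroup_add by easy.
rewrite (linear_scal _ (semigroup_linear T hs)), Cscal_assoc.
now rewrite RtoC_plus, Cmult_plus_distr_l, Cexp_plus.
Qed.

(** Product rule: (e^(kh) U(h) x - x)/h = e^(kh) (U(h) x - x)/h + ((e^(kh) - 1)/h) x. The family [U]
    is arbitrary so that the rule serves both ways, from T with k = -lambda and back from [rescaled]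
    with k = lambda. *)
Lemma generator_lim_rescale (k : C) (U : R -> X -> X) (x y : X) :
  filterlim (fun h : R => scal (RtoC (/ h) : C_AbsRing) (minus (U h x) x))
    (at_right 0) (locally y) ->
  filterlim (fun h : R => scal (RtoC (/ h) : C_AbsRing)
      (minus (scal (Cexp (k * RtoC h)%C : C_AbsRing) (U h x)) x))
    (at_right 0) (locally (plus y (scal (k : C_AbsRing) x))).
Proof.
intros hU.
assert (h := filterlim_comp_2 _ _ _
  (filterlim_comp_2 _ _ _ (@Cexp_right_continuous k) hU (filterlim_scal (V := X) _ _))
  (filterlim_comp_2 _ _ _ (@Cexp_derive_right k) (filterlim_const x) (filterlim_scal (V := X) _ _))
  (filterlim_plus (V := X) _ _)).
assert (e : plus (scal (one : C_AbsRing) y) (scal (k : C_AbsRing) x) =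
    plus y (scal (k : C_AbsRing) x))
  by exact (f_equal (fun z : X => plus z (scal (k : C_AbsRing) x)) (scal_one y)).
rewrite <- e; clear e; revert h; apply filterlim_ext; intros h.
change R in (type of h); cbn [fst snd].
set (e := Cexp (k * RtoC h)).
eapply eq_trans; [apply (f_equal2 plus); [apply scal_comm | symmetry; apply Cscal_assoc] |].
eapply eq_trans; [symmetry; exact (scal_distr_l (RtoC (/ h) : C_AbsRing) _ _) |].
apply f_equal.
eapply eq_trans; [apply (f_equal2 plus);
  [apply scal_minus_right | exact (scal_minus_distr_r (e : C_AbsRing) (one : C_AbsRing) x)] |].
rewrite (scal_one x); symmetry.
exact (minus_trans (scal (e : C_AbsRing) x) _ x).
Qed.

Let Y : NormedModule R_AbsRing := real_module X.

Lemma rescaled_continuous (x : X) :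
  filterlim (fun r => rescaled r x) (at_right 0) (locally x).
Proof.
apply (eq_ind (scal (one : C_AbsRing) x)
  (fun y => filterlim (fun r => rescaled r x) (at_right 0) (locally y))); [| exact (scal_one x)].
exact (filterlim_comp_2 _ _ _ (@Cexp_right_continuous (- lambda)%C) (semigroup_continuous T (x := x))
  (filterlim_scal (V := X) _ _)).
Qed.

Lemma rescaled_real_linear (r : R) : 0 <= r -> is_linear (U := Y) (V := Y) (rescaled r).
Proof. intros hr; now apply is_linear_real, rescaled_linear. Qed.

Definition rescaled_generator (x y : X) : Prop :=
  real_generator (V := real_module X) rescaled x y.

Definition rescaled_integral (p q a : R) (x : X) : X :=
  orbit_integral (V := real_module X) rescaled p q a x.

Lemma generator_lim_rescaled (x y : X) :
  generator_lim T x y -> rescaled_generator x (minus y (scal (lambda : C_AbsRing) x)).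
Proof.
intros h; apply (@generator_lim_rescale (- lambda)%C) in h.
exact (eq_ind (plus y (scal ((- lambda)%C : C_AbsRing) x)) (rescaled_generator x) h _
  (f_equal (fun z : X => plus y z) (scal_opp_l (lambda : C_AbsRing) x))).
Qed.

Lemma rescaled_generator_lim (x z : X) :
  rescaled_generator x z -> generator_lim T x (plus z (scal (lambda : C_AbsRing) x)).
Proof.
intros h; apply (@generator_lim_rescale lambda rescaled) in h; revert h.
apply filterlim_ext; intros r; unfold rescaled; rewrite Cscal_assoc.
replace (Cexp (lambda * r) * Cexp (- lambda * r))%C with (one : C_AbsRing).
- now rewrite (scal_one (T r x)).
- rewrite <- Cexp_plus; replace (lambda * r + - lambda * r)%C with (RtoC 0) by ring.
  symmetry; apply Cexp_zero.
Qed.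

Local Notation B := (op_shift (lambda : C_AbsRing) (generator T)).

Lemma rescaled_generator_op_shift (x z : X) : rescaled_generator x z -> dom B x /\ B x = opp z.
Proof.
intros h; apply rescaled_generator_lim in h; split; [eexists; exact h |].
change (minus (scal (lambda : C_AbsRing) x) (iota (generator_lim T x)) = opp z).
rewrite (generator_lim_iota h), plus_comm, <- opp_minus.
apply f_equal; apply (minus_plus_cancel (scal (lambda : C_AbsRing) x) z).
Qed.

Lemma op_shift_rescaled_generator (x : X) : dom B x -> rescaled_generator x (opp (B x)).
Proof.
intros [y hy].
change (rescaled_generator x (opp (minus (scal (lambda : C_AbsRing) x) (iota (generator_lim T x))))).
rewrite (generator_lim_iota hy), opp_minus; now apply generator_lim_rescaled.
Qed.

Lemma rescaled_homogeneous (a : C_AbsRing) (r : R) (x : X) : 0 <= r ->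
  rescaled r (scal a x) = scal a (rescaled r x).
Proof. intros hr; exact (linear_scal _ (rescaled_linear hr) a x). Qed.

(** The real integral yields real linearity and the bound; complex homogeneity follows because
    multiplication by a complex scalar is a bounded real operator commuting with the semigroup. *)
Lemma rescaled_integral_linear (p q a : R) : 0 <= a -> is_linear (rescaled_integral p q a).
Proof.
intros ha; apply is_linear_complex.
- apply orbit_integral_linear; try easy.
  + exact rescaled_real_linear.
  + exact rescaled_zero.
  + intros; now apply rescaled_add.
  + exact rescaled_continuous.
- intros k x; symmetry.
  apply (@orbit_integral_commute (real_module X) rescaled rescaled_real_linear rescaled_zero
    ltac:(intros; now apply rescaled_add) rescaled_continuous (fun x : X => scal k x)).
  + apply is_linear_real, is_linear_homothety.
  + intros t y ht; symmetry; now apply rescaled_homogeneous.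
Qed.

Lemma rescaled_integral_commute (p q a t : R) (x : X) : 0 <= t ->
  rescaled_integral p q a (rescaled t x) = rescaled t (rescaled_integral p q a x).
Proof.
intros ht; apply (@orbit_integral_semigroup (real_module X) rescaled); try easy.
- exact rescaled_real_linear.
- exact rescaled_zero.
- intros; now apply rescaled_add.
- exact rescaled_continuous.
Qed.

Lemma rescaled_generator_integral (p q a : R) (x : X) : 0 <= a ->
  rescaled_generator (rescaled_integral p q a x)
  (minus (minus (scal (RtoC (p + q * a) : C_AbsRing) (rescaled a x)) (scal (RtoC p : C_AbsRing) x))
    (scal (RtoC q : C_AbsRing) (rescaled_integral 1 0 a x))).
Proof.
intros ha; apply (@real_generator_orbit_integral (real_module X)); try easy.
- exact rescaled_real_linear.
- exact rescaled_zero.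
- intros; now apply rescaled_add.
- exact rescaled_continuous.
Qed.

Lemma rescaled_generator_commute (K : X -> X) (x y : X) : is_linear K ->
  (forall t z, 0 <= t -> K (rescaled t z) = rescaled t (K z)) ->
  rescaled_generator x y -> rescaled_generator (K x) (K y).
Proof.
intros hK hKS; apply (@real_generator_commute (real_module X)); [| easy].
now apply is_linear_real.
Qed.

Lemma rescaled_generator_iff (x y : X) :
  rescaled_generator x y <-> forall h, 0 <= h -> rescaled_integral 1 0 h y = minus (rescaled h x) x.
Proof.
apply (@real_generator_iff (real_module X)).
- exact rescaled_real_linear.
- exact rescaled_zero.
- intros; now apply rescaled_add.
- exact rescaled_continuous.
Qed.

Lemma op_shift_commute (K : X -> X) (x : X) : is_linear K ->
  (forall t z, 0 <= t -> K (rescaled t z) = rescaled t (K z)) ->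
  dom B x -> dom B (K x) /\ B (K x) = K (B x).
Proof.
intros hK hKS hx.
apply op_shift_rescaled_generator, (rescaled_generator_commute hK hKS),
  rescaled_generator_op_shift in hx.
destruct hx as [hd he]; split; [easy |]; rewrite he, (linear_opp _ _ hK).
exact (opp_opp (G := CompleteNormedModule.AbelianGroup C_AbsRing X) _).
Qed.

(** The graph is the intersection over h of the zero sets of continuous maps given by
    [rescaled_generator_iff]. The sign in [opp (snd p)] is there because the rescaled semigroup is
    generated by -B, and [norm ... <= 0] presents each zero set as the preimage of a closed
    half-line. *)
Lemma closed_op_shift_generator : closed_operator B.
Proof.
assert (hD : forall p : X * X, (forall h, 0 <= h ->
    norm (minus (rescaled_integral 1 0 h (opp (snd p))) (minus (rescaled h (fst p)) (fst p))) <= 0) <->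
    dom B (fst p) /\ snd p = B (fst p)).
{ intros [x y]; cbn [fst snd]; split.
  - intros h; assert (hg : rescaled_generator x (opp y)).
    { apply rescaled_generator_iff; intros k hk; specialize (h k hk).
      assert (h0 := norm_eq_zero _ (Rle_antisym _ _ h (norm_ge_0 _))).
      rewrite <- (plus_minus_cancel (minus (rescaled k x) x) (rescaled_integral 1 0 k (opp y))).
      rewrite h0; exact (plus_zero_r (minus (rescaled k x) x)). }
    apply rescaled_generator_op_shift in hg; destruct hg as [hd he]; split; [easy |].
    rewrite he; symmetry; exact (opp_opp (G := CompleteNormedModule.AbelianGroup C_AbsRing X) _).
  - intros [hd ->] h hh.
    rewrite (proj1 (rescaled_generator_iff _ _) (op_shift_rescaled_generator hd) h hh).
    rewrite minus_eq_zero; right; exact (norm_zero (V := X)). }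
intros p hp; apply hD; intros h hh.
refine (closed_comp (fun p : X * X => norm (minus (rescaled_integral 1 0 h (opp (snd p)))
  (minus (rescaled h (fst p)) (fst p)))) (fun r => r <= 0) _ (closed_le 0) p _).
- intros q; apply (continuous_comp (fun p : X * X => minus (rescaled_integral 1 0 h (opp (snd p)))
    (minus (rescaled h (fst p)) (fst p))) (fun z : X => norm z));
    [| exact (filterlim_norm (V := X) _)].
  apply (continuous_minus (V := X)); [| apply (continuous_minus (V := X))].
  + apply (continuous_comp (fun p : X * X => opp (snd p)) (rescaled_integral 1 0 h)).
    * apply (continuous_opp (V := X)), continuous_snd.
    * exact (linear_cont (U := X) (V := X) _ _ (rescaled_integral_linear 1 0 hh)).
  + apply (continuous_comp (fun p : X * X => fst p) (rescaled h)); [apply continuous_fst |].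
    exact (linear_cont (U := X) (V := X) _ _ (rescaled_linear hh)).
  + apply continuous_fst.
- intros hl; apply hp; revert hl; apply filter_imp; intros q hq hq'.
  now apply hq, hD.
Qed.

End RescaledSemigroup.

(** * The spectral inclusion, by contraposition *)

Theorem theorem2p2 (X : CompleteNormedModule C_AbsRing) (T : C0_semigroup X)
    (t : R) (ht : (0 < t)%R) (mu : C) :
  (exists lambda : C,
     QF_spectrum (generator T) lambda /\ mu = Cexp (lambda * RtoC t)%C) ->
  QF_spectrum (semigroup_operator T (Rlt_le 0 t ht)) mu.
Proof.
intros [lambda [hl ->]] hC; apply hl; clear hl.
assert (ht' := Rlt_le 0 t ht).
set (mu := Cexp (lambda * RtoC t)) in *.
pose (J := rescaled_integral T lambda 1 0 t).
assert (hJ : is_linear J) by now apply rescaled_integral_linear.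
assert (hJB : forall x, rescaled_generator T lambda (J x) (minus (rescaled T lambda t x) x)).
{ intros x; assert (h := @rescaled_generator_integral X T lambda 1 0 t x ht').
  replace (1 + 0 * t) with 1 in h by ring.
  exact (eq_ind _ _ h _ (minus_scal_one_zero _ _ _)). }
assert (hmu : forall x, scal (mu : C_AbsRing) (rescaled T lambda t x) = T t x).
{ intros x; unfold rescaled; rewrite Cscal_assoc; unfold mu.
  rewrite <- Cexp_plus; replace (lambda * t + - lambda * t)%C with (RtoC 0) by ring.
  rewrite Cexp_zero; exact (scal_one (T t x)). }
pose (L := fun x => scal (mu : C_AbsRing) (J x)).
assert (hL : is_linear L) by exact (is_linear_comp _ _ hJ (@is_linear_homothety X _)).
assert (hLT : forall s z, 0 <= s -> L (rescaled T lambda s z) = rescaled T lambda s (L z)).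
{ intros s z hs; unfold L, J; rewrite rescaled_integral_commute by easy.
  now rewrite rescaled_homogeneous. }
pose (G := rescaled_integral T lambda 1 (- / t) t).
assert (hBL : forall x, dom (op_shift (lambda : C_AbsRing) (generator T)) (L x) /\
  op_shift (lambda : C_AbsRing) (generator T) (L x) =
  op_shift (mu : C_AbsRing) (semigroup_operator T (Rlt_le 0 t ht)) x).
{ intros x; destruct (rescaled_generator_op_shift (hJB x)) as [hd he].
  split; [now apply carrier_scal |].
  unfold L; rewrite app_scal, he, opp_minus, scal_minus_right, hmu by easy; easy. }
assert (hG : forall s z, 0 <= s -> G (rescaled T lambda s z) = rescaled T lambda s (G z))
  by (intros; now apply rescaled_integral_commute).
assert (hGl : is_linear G) by now apply rescaled_integral_linear.
assert (hBG : forall x,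
  rescaled_generator T lambda (G x) (minus (scal (RtoC (/ t) : C_AbsRing) (J x)) x)).
{ intros x; assert (h := @rescaled_generator_integral X T lambda 1 (- / t) t x ht').
  replace (1 + - / t * t) with 0 in h by (field; lra).
  rewrite RtoC_opp in h; exact (eq_ind _ _ h _ (minus_scal_zero_opp _ _ _ _)). }
(* The coefficient e^(-lambda t)/t undoes the factor e^(lambda t) of L, leaving J/t. *)
assert (hGd : forall x, dom (op_shift (lambda : C_AbsRing) (generator T)) (G x) /\
  x = plus (op_shift (lambda : C_AbsRing) (generator T) (G x))
    (scal (RtoC (/ t) * Cexp (- (lambda * t)) : C)%C (L x))).
{ intros x; destruct (rescaled_generator_op_shift (hBG x)) as [hd he]; split; [easy |].
  rewrite he, opp_minus; unfold L; rewrite Cscal_assoc, <- Cmult_assoc.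
  rewrite (Cmult_comm (Cexp (- _))); unfold mu; rewrite Cexp_opp_l, Cmult_1_r.
  rewrite plus_comm; symmetry; exact (plus_minus_cancel _ x). }
apply (@quasi_Fredholm_factor X (op_shift (lambda : C_AbsRing) (generator T))
  (op_shift (mu : C_AbsRing) (semigroup_operator T (Rlt_le 0 t ht))) L G
  ((RtoC (/ t) * Cexp (- (lambda * t)))%C : C_AbsRing)); try easy.
- exact (linear_zero _ hGl).
- intros x; apply hBL.
- intros x; apply hBL.
(* L commutes with the semigroup, hence with B on D(B), so L B x = B L x = C x. *)
- intros x hx; rewrite <- (proj2 (op_shift_commute hL hLT hx)); apply hBL.
- intros x; apply hGd.
- intros x hx; apply (op_shift_commute hGl hG hx).
- intros x; apply hGd.
- apply closed_op_shift_generator.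
Qed.
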